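(* There exists a non-constant complex rational function $P$ such that the curve $L_P(x,y)=0$ is reducible over $\mathbb{C}$, but $P$ does not satisfy the Composition Condition, i.e. there do not exist a quotient of finite Blaschke products $B$ of degree at least two and a non-constant rational function $W$ such that $P=B\circ W$.
   Context: For a rational function $P$, $\overline{P}$ denotes the rational function obtained from $P$ by complex-conjugating all coefficients. For a non-constant complex rational function $P$, $L_P(x,y)\in\mathbb{C}[x,y]$ is the numerator of the rational function $P(x+iy)\,\overline{P}(x-iy)-1$: if $P=P_1/P_2$ with $P_1,P_2$ coprime polynomials, then $L_P(x,y)=P_1(x+iy)\overline{P_1}(x-iy)-P_2(x+iy)\overline{P_2}(x-iy)$. The curve $L_P(x,y)=0$ is reducible over $\mathbb{C}$ if the polynomial $L_P$ is reducible in $\mathbb{C}[x,y]$. A quotient of finite Blaschke products is a rational function $B$ such that $B(\mathbb{T})\subset\mathbb{T}$, where $\mathbb{T}=\{z\in\mathbb{C}:|z|=1\}$; equivalently, $B(z)\overline{B}(1/z)=1$ for all $z\in\mathbb{C}\cup\{\infty\}$. The degree of a rational function is its degree as a self-map of the Riemann sphere. *)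

(* Defs.v *)
From HB Require Import structures.
From mathcomp Require Import all_boot all_order all_algebra.
From mathcomp Require Import reals complex.

Set Implicit Arguments.
Unset Strict Implicit.
Unset Printing Implicit Defensive.

Import Order.TTheory GRing.Theory Num.Theory.
Local Open Scope ring_scope.
Local Open Scope quotient_scope.

Notation ratfun K := {fraction {poly K}}.
Notation "x %:F" := (@FracField.tofrac _ x) : ring_scope.

Section RationalFunctions.
Variable K : fieldType.
Implicit Types (F B W : ratfun K).

(* Numerator and denominator in lowest terms (ratnum_ratden, coprime_ratfun);
   they are determined by F up to a common nonzero scalar factor
   (ratfun_lowest_terms). *)
Definition ratnum F : {poly K} :=
  \n_(repr F) %/ gcdp \n_(repr F) \d_(repr F).
Definition ratden F : {poly K} :=
  \d_(repr F) %/ gcdp \n_(repr F) \d_(repr F).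

Definition nonconstant F : Prop := forall c : K, F <> c%:P%:F.

Definition ratdeg F : nat := (maxn (size (ratnum F)) (size (ratden F))).-1.

(* B o W: B is evaluated at W in the field K(z), K being embedded as constants.
   The division is a genuine one when W is not constant, since W is then
   transcendental over K. *)
Definition ratcomp B W : ratfun K :=
  (map_poly (fun c : K => c%:P%:F) (ratnum B)).[W] /
  (map_poly (fun c : K => c%:P%:F) (ratden B)).[W].

(* K[x, y] is {poly {poly K}}; a unit is a nonzero constant. *)
Definition reducible2 (L : {poly {poly K}}) : Prop :=
  L != 0 /\
  exists f g : {poly {poly K}},
    [/\ f \isn't a GRing.unit, g \isn't a GRing.unit & L = f * g].

Lemma ratden_neq0 F : ratden F != 0.
Proof.
have d0 := denom_ratioP (repr F).
by rewrite /ratden dvdp_div_eq0 // dvdp_gcdr.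
Qed.

Lemma coprime_ratfun F : coprimep (ratnum F) (ratden F).
Proof.
by apply: coprimep_div_gcd; rewrite denom_ratioP orbT.
Qed.

Lemma ratnum_ratden F : F = (ratnum F)%:F / (ratden F)%:F.
Proof.
have d0 := denom_ratioP (repr F).
have g0 : gcdp \n_(repr F) \d_(repr F) != 0 by rewrite gcdp_eq0 negb_and d0 orbT.
have e : F * (\d_(repr F))%:F = (\n_(repr F))%:F.
  rewrite -[F in LHS]reprK; apply/eqP; rewrite !piE FracField.equivfE.
  rewrite /FracField.mulf !numden_Ratio ?mulr1 ?oner_neq0 ?mulf_neq0 ?d0 //.
  by rewrite reprK mulrC.
rewrite -[LHS](mulfK (x := (ratden F)%:F)) ?tofrac_eq0 ?ratden_neq0 //.
congr (_ / _).
have gF0 : (gcdp \n_(repr F) \d_(repr F))%:F != 0 by rewrite tofrac_eq0.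
apply: (mulIf gF0); rewrite -mulrA -!tofracM.
by rewrite !divpK ?dvdp_gcdl ?dvdp_gcdr.
Qed.

Lemma ratfun_lowest_terms F (p q : {poly K}) :
    coprimep p q -> q != 0 -> F = p%:F / q%:F ->
  exists2 c : K, c != 0 & ratnum F = c *: p /\ ratden F = c *: q.
Proof.
move=> cpq q0 eF.
have d0 := ratden_neq0 F; have cF := coprime_ratfun F.
have /eqP e : ratnum F * q == p * ratden F.
  rewrite -tofrac_eq !tofracM -eqr_div ?tofrac_eq0 //.
  by rewrite -ratnum_ratden eF.
have qd : q %= ratden F.
  apply/andP; split.
    have cqp : coprimep q p by rewrite coprimep_sym.
    by rewrite -(Gauss_dvdpr (ratden F) cqp) -e dvdp_mulIr.
  have cdn : coprimep (ratden F) (ratnum F) by rewrite coprimep_sym.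
  by rewrite -(Gauss_dvdpr q cdn) e dvdp_mulIr.
have /eqpf_eq[c c0 eq] : ratden F %= q by rewrite eqp_sym.
exists c => //; split=> //; apply: (mulIf q0).
by rewrite e eq -scalerAr -scalerAl.
Qed.

End RationalFunctions.

Section Curve.
Variable K : numClosedFieldType.
Implicit Types (p : {poly K}) (P B : ratfun K).

(* The substitution p(x + a y), the outer 'X being x and 'Y = 'X%:P being y. *)
Definition subst_lin p (a : K) : {poly {poly K}} :=
  p^:P \Po ('X + a%:P%:P * 'Y).

Definition L_poly P : {poly {poly K}} :=
  subst_lin (ratnum P) 'i * subst_lin (map_poly Num.conj (ratnum P)) (- 'i) -
  subst_lin (ratden P) 'i * subst_lin (map_poly Num.conj (ratden P)) (- 'i).

(* B maps the unit circle to itself; in lowest terms a zero of the denominator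
   is a pole, where the value is infinity. *)
Definition blaschke_quotient B : Prop :=
  forall z : K, `|z| = 1 ->
    (ratden B).[z] != 0 /\ `|(ratnum B).[z] / (ratden B).[z]| = 1.

Definition composition_condition P : Prop :=
  exists B W : ratfun K,
    [/\ blaschke_quotient B, (2 <= ratdeg B)%N, nonconstant W
      & P = ratcomp B W].

End Curve.

(* Main.v *)
(** Take P = (T - 1) / (T + 1), where T = 8 z^4 - 8 z^2 + 1 is the Chebyshev
    polynomial of degree 4.  With z = x + iy and w = x - iy, the curve
    P(z) conj(P)(w) = 1 is T(z) + T(w) = 0, and
    T(z) + T(w) = 2 ((2 z^2 + 2 w^2 - 1)^2 - 8 z^2 w^2) is a difference of
    squares.
    If P = B o W with B = n/d a quotient of Blaschke products of degree m >= 2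
    and W = a/b, then the value 1 of P is only taken at infinity, so the value 1
    of B is only taken at one point w0, and w0 lies on the unit circle because
    the fibre B = 1 is stable under reflection; moreover a - w0 b is constant.
    A Cayley transform then turns W into a polynomial V and B into a polynomial
    G of degree m with T/2 = G(V) and with purely imaginary coefficients.  As m
    divides 4, comparing coefficients shows that V takes the real value
    - G_{m-1} / (m G_m) at a root of z = 0 or of 2 z^2 = 1, where T is real and
    nonzero although G is purely imaginary on the real line. *)

Require Import Defs.
From mathcomp Require Import all_boot all_order all_algebra.
From mathcomp Require Import reals complex.
From mathcomp Require Import ring zify.

Set Implicit Arguments.
Unset Strict Implicit.
Unset Printing Implicit Defensive.

Import Order.TTheory GRing.Theory Num.Theory.
Local Open Scope ring_scope.

(** * Polynomial identities from infinitely many test points *)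

Lemma poly0_inj_roots (F : idomainType) (p : {poly F}) (x : nat -> F) :
  injective x -> (forall k, p.[x k] = 0) -> p = 0.
Proof.
move=> xI px0; apply/eqP; apply: contraT => p0.
have := max_poly_roots (rs := mkseq x (size p)) p0.
rewrite size_mkseq ltnn => -> //; last by rewrite mkseq_uniq.
by apply/allP => _ /mapP[k _ ->]; apply/rootP.
Qed.

Section NumClosed.
Variable K : numClosedFieldType.
Implicit Types (p q n d a b : {poly K}) (z u w s : K).

Lemma natr_inj : injective (fun k : nat => k%:R : K).
Proof. by move=> i j /eqP; rewrite eqr_nat => /eqP. Qed.

Lemma poly_eq_off_roots p q b : b != 0 ->
  (forall z, b.[z] != 0 -> p.[z] = q.[z]) -> p = q.
Proof.
move=> b0 pq; apply: (mulIf b0); apply/eqP; rewrite -subr_eq0; apply/eqP.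
apply: (poly0_inj_roots natr_inj) => k; rewrite !hornerE.
by have [->|/pq->] := eqVneq b.[k%:R] 0; rewrite ?mulr0 subrr.
Qed.

Lemma size1_no_root p : (forall z, p.[z] != 0) -> size p = 1%N.
Proof.
move=> p0; apply/eqP; apply: contraT => /closed_rootP[z /rootP pz].
by have := p0 z; rewrite pz eqxx.
Qed.

(** * Homogenisation and composition of rational functions *)

(** For [n] of degree at most [m] this is [b^m n(a/b)] written without division, so it keeps a
    meaning at the zeros of [b], the poles of [a/b]. *)
Definition homog m n a b : {poly K} :=
  \sum_(i < m.+1) n`_i *: (a ^+ i * b ^+ (m - i)).

Lemma homogB m n d a b : homog m (d - n) a b = homog m d a b - homog m n a b.
Proof.
rewrite /homog -sumrB; apply: eq_bigr => i _.
by rewrite coefB scalerBl.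
Qed.

(** The morphism [phi] allows two uses: evaluation at a point ([phi] the identity) and passage to
    the function field ([phi] the embedding of constants). *)
Lemma homog_map (E : fieldType) (phi : {rmorphism K -> E}) m n (x y : E) :
    (size n <= m.+1)%N -> y != 0 ->
  \sum_(i < m.+1) phi n`_i * (x ^+ i * y ^+ (m - i)) =
  y ^+ m * (map_poly phi n).[x / y].
Proof.
move=> sn y0; rewrite (horner_coef_wide _ (n := m.+1)) ?size_map_poly //.
rewrite big_distrr; apply: eq_bigr => i _ /=; rewrite coef_map.
have -> : y ^+ m = y ^+ (m - i) * y ^+ i by rewrite -exprD subnK // -ltnS.
by rewrite exprMn exprVn; field; rewrite expf_neq0.
Qed.

Lemma horner_homog_sum m n a b z :
  (homog m n a b).[z] =
  \sum_(i < m.+1) n`_i * (a.[z] ^+ i * b.[z] ^+ (m - i)).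
Proof.
rewrite /homog horner_sum; apply: eq_bigr => i _.
by rewrite hornerZ hornerM !horner_exp.
Qed.

Lemma horner_homog m n a b z : (size n <= m.+1)%N -> b.[z] != 0 ->
  (homog m n a b).[z] = b.[z] ^+ m * n.[a.[z] / b.[z]].
Proof.
move=> sn bz; rewrite horner_homog_sum.
by rewrite (homog_map (@idfun K)) // map_poly_id.
Qed.

Lemma horner_homog_root m n a b z : b.[z] = 0 ->
  (homog m n a b).[z] = n`_m * a.[z] ^+ m.
Proof.
move=> bz; rewrite horner_homog_sum (bigD1 ord_max) //= subnn mulr1.
rewrite big1 ?addr0 // => i im; rewrite bz expr0n subn_eq0.
have : (i < m)%N by rewrite ltn_neqAle -ltnS ltn_ord andbT.
by rewrite ltnNge => /negPf->; rewrite !mulr0.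
Qed.

Lemma tofrac_homog m n a b : (size n <= m.+1)%N -> b != 0 ->
  (homog m n a b)%:F =
  (b%:F) ^+ m * (map_poly (fun c : K => c%:P%:F) n).[a%:F / b%:F].
Proof.
move=> sn b0.
have -> : map_poly (fun c : K => c%:P%:F) n =
          map_poly (@FracField.tofrac _ \o polyC) n by [].
rewrite -(@homog_map _ (@FracField.tofrac _ \o polyC)) ?tofrac_eq0 //.
rewrite /homog rmorph_sum; apply: eq_bigr => i _.
by rewrite -mul_polyC !rmorphM !rmorphXn.
Qed.

(** At a common root [z] with [b(z)] nonzero, [a(z)/b(z)] would be a common root of [n] and [d]. If
    [b(z) = 0], then [a(z)] is nonzero and the two values are the degree [m] coefficients times
    [a(z)^m], not both zero. *)
Lemma coprimep_homog m n d a b :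
    coprimep n d -> coprimep a b -> (size n <= m.+1)%N -> (size d <= m.+1)%N ->
    n`_m != 0 \/ d`_m != 0 ->
  coprimep (homog m n a b) (homog m d a b).
Proof.
move=> cnd cab sn sd ndm; apply: Pdiv.ClosedField.root_coprimep => z /rootP.
have [bz|bz] := eqVneq b.[z] 0.
  have az : a.[z] != 0.
    rewrite coprimep_sym in cab.
    by apply: (coprimep_root cab); apply/rootP.
  rewrite !horner_homog_root // => /eqP; rewrite mulf_eq0 => /orP[/eqP nm|].
    by case: ndm => [|dm]; rewrite ?nm ?eqxx // mulf_neq0 ?expf_neq0.
  by rewrite expf_eq0 (negPf az) andbF.
rewrite !horner_homog // => /eqP; rewrite mulf_eq0 expf_eq0 (negPf bz) andbF /=.
by move=> nz; rewrite mulf_neq0 ?expf_neq0 // (coprimep_root cnd).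
Qed.

Lemma size_ratnum_ratden (B : ratfun K) :
  [/\ (size (ratnum B) <= (ratdeg B).+1)%N, (size (ratden B) <= (ratdeg B).+1)%N
    & size (ratnum B) = (ratdeg B).+1 \/ size (ratden B) = (ratdeg B).+1].
Proof.
have : (0 < size (ratden B))%N by rewrite size_poly_gt0 ratden_neq0.
rewrite /ratdeg => sd; case: (leqP (size (ratnum B)) (size (ratden B))) => h.
  by rewrite prednK //; split=> //; right.
by rewrite (ltn_predK h); split=> //; [exact: ltnW|left].
Qed.

(** The homogenised numerator and denominator of [B] are coprime, so they are the lowest terms of
    the composite up to one scalar. *)
Lemma ratcomp_homog (P B W : ratfun K) m :
    m = ratdeg B -> nonconstant P -> P = ratcomp B W ->
  exists2 k, k != 0 &
    homog m (ratnum B) (ratnum W) (ratden W) = k *: ratnum P /\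
    homog m (ratden B) (ratnum W) (ratden W) = k *: ratden P.
Proof.
move=> mE Pnc PE.
set n := ratnum B in PE *; set d := ratden B in PE *.
set a := ratnum W; set b := ratden W.
have b0 : b != 0 := ratden_neq0 W.
have [] := size_ratnum_ratden B; rewrite -mE -/n -/d => sn sd snd.
have ndm : n`_m != 0 \/ d`_m != 0.
  have lc p : size p = m.+1 -> p`_m != 0.
    by move=> sp; rewrite -[m]/(m.+1.-1) -sp -lead_coefE lead_coef_eq0 -size_poly_gt0 sp.
  by case: snd => /lc; [left|right].
have PE' : P = (homog m n a b)%:F / (homog m d a b)%:F.
  have bm : (b%:F) ^+ m != 0 by rewrite expf_neq0 ?tofrac_eq0.
  rewrite !tofrac_homog // -mulf_div divff // mul1r {1}PE /ratcomp -/n -/d.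
  by rewrite [in LHS](ratnum_ratden W).
have hd0 : homog m d a b != 0.
  (* Division by 0 yields 0, so a zero denominator would make [P] the constant 0. *)
  apply/eqP => hd; move: PE'; rewrite hd rmorph0 invr0 mulr0 => P0.
  by apply: (Pnc 0); rewrite P0 !rmorph0.
have cF := coprime_ratfun P.
have cnd : coprimep (homog m n a b) (homog m d a b).
  by apply: coprimep_homog => //; apply: coprime_ratfun.
have [c c0 [-> ->]] := ratfun_lowest_terms cnd hd0 PE'.
by exists c^-1; rewrite ?invr_eq0 // !scalerA mulVf // !scale1r.
Qed.

(** * Reflection in the unit circle *)

(* X^m times the conjugate of p(1 / conj X). *)
Definition revconj m p := homog m (map_poly Num.conj p) 1 'X.

Lemma size_revconj m p : (size (revconj m p) <= m.+1)%N.
Proof.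
apply: (leq_trans (size_sum _ _ _)); apply/bigmax_leqP => i _.
apply: (leq_trans (size_scale_leq _ _)).
by rewrite expr1n mul1r size_polyXn ltnS leq_subr.
Qed.

Lemma horner_revconj m p u : (size p <= m.+1)%N -> u != 0 ->
  (revconj m p).[u] = u ^+ m * (p.[(u^-1)^*])^*.
Proof.
move=> sp u0; rewrite /revconj horner_homog ?size_map_poly ?hornerX //.
by rewrite hornerE div1r -{1}[u^-1]conjCK horner_map.
Qed.

Lemma horner_revconj0 m p : (revconj m p).[0] = (p`_m)^*.
Proof.
by rewrite /revconj horner_homog_root ?hornerX // hornerE expr1n mulr1 coef_map.
Qed.

Definition cayley (t : K) := (t + 'i) / (t - 'i).

Lemma real_neq_i (t : K) : t \is Num.real -> t - 'i != 0 /\ t + 'i != 0.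
Proof.
move=> tr; have i0 := neq0Ci K.
have ii : 'i *+ 2 != 0 :> K by rewrite mulrn_eq0.
suff h (x : K) : x \is Num.real -> x - 'i != 0.
  split; first exact: h.
  rewrite -oppr_eq0 opprD; apply: h; by rewrite rpredN.
move=> xr; apply/eqP => /eqP; rewrite subr_eq0 => /eqP xi.
have := conj_Creal xr; rewrite xi conjCi => /eqP.
by rewrite -subr_eq0 -opprD oppr_eq0 -mulr2n (negPf ii).
Qed.

Lemma norm_cayley (t : K) : t \is Num.real -> `|cayley t| = 1.
Proof.
move=> tr; have [t1 t2] := real_neq_i tr.
have e : t - 'i = (t + 'i)^* by rewrite rmorphD /= conjCi conj_Creal.
by rewrite /cayley normf_div e norm_conjC divff // normr_eq0.
Qed.

Lemma cayley_inj : {in Num.real &, injective cayley}.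
Proof.
move=> s t sr tr; rewrite /cayley => /eqP.
have [s1 _] := real_neq_i sr; have [t1 _] := real_neq_i tr.
rewrite eqr_div // => /eqP e; apply/eqP; rewrite -subr_eq0.
have i2 : 'i *+ 2 != 0 :> K by rewrite mulrn_eq0 neq0Ci.
apply/eqP; apply: (mulfI i2); rewrite mulr0.
have -> : 'i *+ 2 * (s - t) = (t + 'i) * (s - 'i) - (s + 'i) * (t - 'i) by ring.
by rewrite e subrr.
Qed.

(** Write [n*], [d*] for the reversed conjugates. On the unit circle [|n| = |d|] reads
    [n n* = d d*], which then holds identically. By coprimality [d] divides [n*] and [n] divides
    [d*], with the same cofactor. *)
Lemma blaschke_revconj (B : ratfun K) m :
    blaschke_quotient B -> m = ratdeg B ->
  exists2 f, f != 0 & revconj m (ratnum B) = f *: ratden B /\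
                      revconj m (ratden B) = f *: ratnum B.
Proof.
move=> Bb mE; have [] := size_ratnum_ratden B; rewrite -mE.
have cnd := coprime_ratfun B; move: Bb; rewrite /blaschke_quotient.
set n := ratnum B in cnd *; set d := ratden B in cnd *.
move=> Bb sn sd snd.
have n0 u : `|u| = 1 -> n.[u] != 0.
  move=> /Bb[_ /eqP]; apply: contraL => /eqP->.
  by rewrite mul0r normr0 eq_sym oner_eq0.
(* Infinitely many distinct points of the unit circle. *)
pose x (k : nat) := cayley k%:R.
have xr k : k%:R \is @Num.real K by rewrite rpred_nat.
have x1 k : `|x k| = 1 by apply: norm_cayley.
have xI : injective x by move=> i j /(cayley_inj (xr i) (xr j))/natr_inj.
have x0 k : x k != 0 by rewrite -normr_eq0 x1 oner_eq0.
have e : n * revconj m n = d * revconj m d.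
  apply/eqP; rewrite -subr_eq0; apply/eqP; apply: (poly0_inj_roots xI) => k.
  have xV : ((x k)^-1)^* = x k by rewrite invC_norm x1 expr1n invr1 mul1r conjCK.
  rewrite hornerD hornerN !hornerM !horner_revconj // xV.
  rewrite !(mulrCA _.[_]) -!normCK.
  by have [_] := Bb _ (x1 k); rewrite normf_div => /divr1_eq->; rewrite subrr.
have d0 : d != 0 := ratden_neq0 B.
have nn0 : n != 0 by apply/eqP => n1; have := n0 _ (x1 0); rewrite n1 horner0 eqxx.
have /dvdpP[g gE] : d %| revconj m n.
  have cdn : coprimep d n by rewrite coprimep_sym.
  by rewrite -(Gauss_dvdpr _ cdn) e dvdp_mulIl.
have /dvdpP[h hE] : n %| revconj m d.
  by rewrite -(Gauss_dvdpr _ cnd) -e dvdp_mulIl.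
have gh : g = h.
  apply: (mulIf d0); apply: (mulfI nn0); rewrite -gE e hE; ring.
have rn0 : revconj m n != 0.
  apply/eqP => rn; have : (revconj m n).[x 0] != 0.
    by rewrite horner_revconj // mulf_neq0 ?expf_neq0 // conjC_eq0 n0 // norm_conjC
      normfV x1 invr1.
  by rewrite rn horner0 eqxx.
have g0 : g != 0 by apply: contraNneq rn0 => g0; rewrite gE g0 mul0r.
have g1 : (size g <= 1)%N.
  (* One of [n], [d] has degree exactly [m], and the reversals have degree at most [m], so the
     cofactor is constant. *)
  case: snd => sE; [have := size_revconj m d | have := size_revconj m n];
  by rewrite ?gE ?hE -?gh size_mul // sE addnS /= -[m.+1]add1n leq_add2r.
have [c gc] : exists c, g = c%:P by exists g`_0; apply: size1_polyC.
exists c; first by rewrite -polyC_eq0 -gc.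
by rewrite gE hE -gh gc !mul_polyC.
Qed.

(** * Decompositions of the Chebyshev polynomial *)

(** Comparison of coefficients: the difference of two expansions is given as an explicit list. *)
Lemma horner_Poly0 (s : seq K) :
  (forall z, (Poly s).[z] = 0) -> forall i, s`_i = 0.
Proof.
move=> s0 i; rewrite -coef_Poly.
by rewrite (poly0_inj_roots natr_inj (fun k => s0 k%:R)) coef0.
Qed.

Lemma horner_size3 p z : (size p <= 3)%N ->
  p.[z] = p`_0 + p`_1 * z + p`_2 * z ^+ 2.
Proof.
move=> sp; rewrite (horner_coef_wide _ sp) !big_ord_recr big_ord0 /=; ring.
Qed.

Lemma horner_size5 p z : (size p <= 5)%N ->
  p.[z] = p`_0 + p`_1 * z + p`_2 * z ^+ 2 + p`_3 * z ^+ 3 + p`_4 * z ^+ 4.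
Proof.
move=> sp; rewrite (horner_coef_wide _ sp) !big_ord_recr big_ord0 /=; ring.
Qed.

(* (T - 1) / 2, so that T / 2 = cheb + 1 / 2. *)
Definition cheb : {poly K} := 4 *: 'X^4 - 4 *: 'X^2.

Lemma horner_cheb z : cheb.[z] = 4 * z ^+ 4 - 4 * z ^+ 2.
Proof. by rewrite /cheb !hornerE. Qed.

Lemma horner_cheb0 : cheb.[0] = 0.
Proof. by rewrite horner_cheb !expr0n !mulr0 subrr. Qed.

(** [G] is purely imaginary at real points. In each remaining pair of degrees, (4, 1) and (2, 2),
    some [z] has [V(z)] real and [G(V(z))] equal to 1/2 or -1/2. *)
Lemma cheb_comp_imaginary (G V : {poly K}) :
    cheb + (2^-1)%:P = G \Po V -> map_poly Num.conj G = - G ->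
  (size G <= 2)%N.
Proof.
move=> GV Gi.
have n2 : 2 != 0 :> K by rewrite pnatr_eq0.
have n4 : 4 != 0 :> K by rewrite pnatr_eq0.
have GVz z : G.[V.[z]] = 4 * z ^+ 4 - 4 * z ^+ 2 + 2^-1.
  by rewrite -horner_comp -GV hornerD hornerC horner_cheb.
have Gc i : (G`_i)^* = - G`_i by rewrite -coef_map Gi coefN.
have Gr t : t^* = t -> (G.[t])^* = - G.[t].
  by move=> tr; rewrite -[(_.[_])^*]horner_map /= Gi tr hornerN.
have real_absurd (x : K) : x != 0 -> x^* = x -> x^* = - x -> False.
  by move=> x0 -> /eqP; rewrite -subr_eq0 opprK -mulr2n mulrn_eq0 (negPf x0).
have sz : 4%N = ((size G).-1 * (size V).-1)%N.
  have s5 : size (cheb + (2^-1)%:P) = 5%N.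
    rewrite size_polyDl; last first.
      rewrite /cheb size_polyDl ?size_polyN !size_scale // !size_polyXn //.
      by rewrite (leq_ltn_trans (size_polyC_leq1 _)).
    by rewrite /cheb size_polyDl ?size_polyN !size_scale // !size_polyXn.
  by have := size_comp_poly G V; rewrite -GV s5.
rewrite leqNgt; apply/negP => sG.
have [[sG5 sV2]|[sG3 sV3]] :
    (size G = 5%N /\ size V = 2%N) \/ (size G = 3%N /\ size V = 3%N).
  move: sz sG; case: (size G) => [|[|[|[|[|[|j]]]]]] //=;
  case: (size V) => [|[|[|[|l]]]] //=; rewrite ?mulSn ?mulnS; lia.
- have G4 : G`_4 != 0.
    by rewrite -[4%N]/(5.-1) -sG5 -lead_coefE lead_coef_eq0 -size_poly_gt0 sG5.
  have v1 : V`_1 != 0.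
    by rewrite -[1%N]/(2.-1) -sV2 -lead_coefE lead_coef_eq0 -size_poly_gt0 sV2.
  have V2 : V`_2 = 0 by rewrite nth_default ?sV2.
  pose c3 := V`_1 ^+ 3 * (4 * G`_4 * V`_0 + G`_3).
  (* Coefficients of [G(V(z)) - cheb(z) - 1/2]. The vanishing of [c3] makes [V_0 = V(0)] a quotient
     of imaginary numbers, hence real. *)
  have : [:: G.[V`_0] - 2^-1;
      V`_1 * (G`_1 + 2 * G`_2 * V`_0 + 3 * G`_3 * V`_0 ^+ 2 + 4 * G`_4 * V`_0 ^+ 3);
      V`_1 ^+ 2 * (G`_2 + 3 * G`_3 * V`_0 + 6 * G`_4 * V`_0 ^+ 2) + 4;
      c3; G`_4 * V`_1 ^+ 4 - 4]`_3 = 0.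
    apply: horner_Poly0 => z; have := GVz z.
    rewrite horner_Poly /= !(horner_size5 _ (p := G)) ?sG5 //.
    rewrite horner_size3 ?sV2 // V2 => h; rewrite /c3.
    rewrite -[RHS](subrr (4 * z ^+ 4 - 4 * z ^+ 2 + 2^-1)) -{1}h; ring.
  move=> /= /eqP; rewrite mulf_eq0 expf_eq0 (negPf v1) /= => /eqP e.
  have v0 : V`_0 = - (G`_3 / (4 * G`_4)).
    apply: (mulfI (mulf_neq0 n4 G4)); apply/eqP.
    rewrite -subr_eq0 -[X in _ == X]e; apply/eqP; field.
    by rewrite G4.
  have v0r : (V`_0)^* = V`_0.
    by rewrite v0 rmorphN fmorph_div rmorphM rmorph_nat /= !Gc; field; rewrite G4.
  apply: (real_absurd 2^-1); rewrite ?invr_eq0 ?fmorphV ?rmorph_nat //.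
  have := GVz 0; rewrite !expr0n /= !mulr0 subrr add0r horner_coef0 => GV0.
  by have := Gr _ v0r; rewrite GV0 fmorphV rmorph_nat.
- have G2 : G`_2 != 0.
    by rewrite -[2%N]/(3.-1) -sG3 -lead_coefE lead_coef_eq0 -size_poly_gt0 sG3.
  have v2 : V`_2 != 0.
    by rewrite -[2%N]/(3.-1) -sV3 -lead_coefE lead_coef_eq0 -size_poly_gt0 sV3.
  (* Completing the square: G = G_2 (X + e)^2 + constant. *)
  pose e := G`_1 / (2 * G`_2); pose u0 := V`_0 + e.
  have er : e^* = e.
    by rewrite /e fmorph_div rmorphM rmorph_nat /= !Gc; field; rewrite G2.
  have eqc : forall i, [:: G`_0 - G`_2 * e ^+ 2 + G`_2 * u0 ^+ 2 - 2^-1;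
      2 * G`_2 * V`_1 * u0; G`_2 * (2 * V`_2 * u0 + V`_1 ^+ 2) + 4;
      2 * G`_2 * V`_2 * V`_1; G`_2 * V`_2 ^+ 2 - 4]`_i = 0.
    apply: horner_Poly0 => z; have := GVz z.
    rewrite horner_Poly /= (horner_size3 _ (p := G)) ?sG3 //.
    rewrite horner_size3 ?sV3 // => h; rewrite /u0 /e.
    rewrite -[RHS](subrr (4 * z ^+ 4 - 4 * z ^+ 2 + 2^-1)) -{1}h; field.
    by rewrite G2.
  have v1 : V`_1 = 0.
    by have /= /eqP := eqc 3; rewrite !mulf_eq0 (negPf n2) (negPf G2) (negPf v2) => /eqP.
  (* The coefficients of [z^2] and [z^4] give [2 G_2 V_2 u0 = -4 = - G_2 V_2^2]. *)
  have u0E : u0 = - V`_2 / 2.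
    have /= e2 := eqc 2; have /= e4 := eqc 4.
    apply: (mulfI (mulf_neq0 (mulf_neq0 n2 G2) v2)).
    have -> : 2 * G`_2 * V`_2 * u0 = - 4.
      by apply/eqP; rewrite -subr_eq0 opprK -[X in _ == X]e2 v1; apply/eqP; ring.
    have <- : G`_2 * V`_2 ^+ 2 = 4 by apply/eqP; rewrite -subr_eq0 e4.
    by field.
  (* Here [u0 + V_2 z^2 = 0], so [V(z)] is the real number [-e], while [cheb(z) + 1/2 = -1/2]. *)
  pose z := sqrtC (2^-1 : K).
  have zz : z ^+ 2 = 2^-1 by rewrite sqrtCK.
  have Vz : V.[z] = - e.
    rewrite horner_size3 ?sV3 // v1 zz mul0r addr0.
    have -> : V`_0 = u0 - e by rewrite addrK.
    by rewrite u0E; field.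
  apply: (real_absurd 2^-1); rewrite ?invr_eq0 ?fmorphV ?rmorph_nat //.
  have Gz : G.[V.[z]] = - 2^-1.
    by rewrite GVz -[4%N]/(2 * 2)%N exprM zz; field.
  have := Gr (- e); rewrite rmorphN /= er -Vz => /(_ erefl).
  rewrite Gz rmorphN fmorphV rmorph_nat /= opprK => /eqP.
  by rewrite eq_sym => /eqP.
Qed.

(** * Failure of the Composition Condition *)

Lemma revconjB m p q : revconj m (p - q) = revconj m p - revconj m q.
Proof. by rewrite /revconj rmorphB homogB. Qed.

(** This is [(T - 1) / (T + 1)] with both terms halved, so that denominator minus numerator is 1. *)
Definition cheb_ratfun : ratfun K := cheb%:F / (cheb + 1)%:F.

Lemma cheb_lowest_terms : exists2 c : K, c != 0 &
  ratnum cheb_ratfun = c *: cheb /\ ratden cheb_ratfun = c *: (cheb + 1).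
Proof.
apply: ratfun_lowest_terms => //.
  apply: Pdiv.ClosedField.root_coprimep => z /rootP z0.
  by rewrite hornerD z0 add0r hornerE oner_eq0.
apply/eqP => /(congr1 (horner^~ 0)); rewrite hornerD horner_cheb0 add0r.
by rewrite hornerC horner0 => /eqP; rewrite oner_eq0.
Qed.

Lemma cheb_nonconstant : nonconstant cheb_ratfun.
Proof.
move=> x; have [c c0 [en ed]] := cheb_lowest_terms.
have F0 : (cheb + 1)%:F != 0.
  by have := ratden_neq0 cheb_ratfun; rewrite ed scaler_eq0 tofrac_eq0 => /norP[].
move=> /(canRL (divfK F0)); rewrite -rmorphM => /eqP; rewrite tofrac_eq => /eqP e.
(* The values of [cheb] at 0 and 2 are 0 and 48. *)
have ez z := congr1 (horner^~ z) e.
have := ez 0; rewrite /= horner_cheb0 hornerM hornerD horner_cheb0 !hornerC add0r mulr1.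
move=> x0; have := ez 2; rewrite /= -x0 mul0r horner0 horner_cheb => /eqP.
have -> : 4 * 2 ^+ 4 - 4 * 2 ^+ 2 = 48%:R :> K by ring.
by rewrite pnatr_eq0.
Qed.

Lemma cheb_no_composition : ~ composition_condition cheb_ratfun.
Proof.
move=> [B [W [Bb Bdeg Wnc PE]]].
have [c c0 [en ed]] := cheb_lowest_terms.
have [k' k'0] := ratcomp_homog (erefl _) cheb_nonconstant PE.
have [f f0 [fn fd]] := blaschke_revconj Bb (erefl _).
have [sn sd _] := size_ratnum_ratden B.
rewrite en ed !scalerA.
have := Wnc; rewrite {1}/nonconstant {PE}.
have WE := ratnum_ratden W; have b0 := ratden_neq0 W.
have cab := coprime_ratfun W; move: Bb; rewrite /blaschke_quotient.
move: (ratdeg B) Bdeg fn fd sn sd => m m2.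
move: (ratnum B) (ratden B) (ratnum W) (ratden W) WE b0 cab => n d a b.
move=> WE b0 cab fn fd sn sd Bb _; have := mulf_neq0 k'0 c0.
move: (k' * c) => k k0 [hn hd].
(* The roots of [e] form the fibre [B = 1]. *)
pose e := d - n.
have se : (size e <= m.+1)%N.
  by rewrite (leq_trans (size_polyD _ _)) // geq_max size_polyN sd.
have he : homog m e a b = k%:P.
  by rewrite homogB hn hd -scalerBr addrAC subrr add0r -mul_polyC mulr1.
have he0 z : (homog m e a b).[z] != 0 by rewrite he hornerC.
(* Reflection exchanges [n] and [d] up to [f], so the roots of [e] are stable under reflection. *)
have re : revconj m e = - f *: e.
  by rewrite revconjB fn fd -scalerBr scaleNr -scalerN opprB.
(* homog m e a b = k has no zero, hence neither has a - w b for a root w of e. *)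
have root_line w : e.[w] = 0 -> exists2 s, s != 0 & a = w *: b + s%:P.
  move=> ew; have /eqP/size_poly1P[s s0 sE] : size (a - w *: b) = 1%N.
    apply: size1_no_root => z; apply: contra (he0 z).
    rewrite !hornerE subr_eq0 => /eqP az.
    have [bz|bz] := eqVneq b.[z] 0.
      have /negP[] : b.[z] != 0; last by apply/eqP.
      by apply: (coprimep_root cab); apply/rootP; rewrite az bz mulr0.
    by rewrite horner_homog // az mulfK // ew mulr0.
  by exists s => //; rewrite -sE addrC subrK.
(* A constant [b] would make [W] constant. At a root of [b] the homogenised [e] is [e_m a^m], which
   must be nonzero. *)
have em0 (ez : exists w, e.[w] = 0) : size b <> 1%N /\ e`_m != 0.
  have bnc : size b <> 1%N.
    have [w /root_line[s s0 aE]] := ez.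
    move=> /eqP/size_poly1P[b1 b10 bE]; apply: (Wnc ((w * b1 + s) / b1)).
    rewrite WE aE bE; apply: (canLR (mulfK _)).
      by rewrite tofrac_eq0 polyC_eq0.
    by rewrite -rmorphM -polyCM divfK // polyCD polyCM mul_polyC.
  split=> //; have /closed_rootP[z /rootP bz] : size b != 1%N by apply/eqP.
  by have := he0 z; rewrite horner_homog_root // mulf_eq0 => /norP[].
(* Reflection exchanges infinity and 0. *)
have em_0 : e`_m = 0 -> e.[0] = 0.
  move=> em; have := horner_revconj0 m e; rewrite em conjC0 re hornerZ => /eqP.
  by rewrite mulf_eq0 oppr_eq0 (negPf f0) => /eqP.
have [w0 ew0] : exists w, e.[w] = 0.
  have [/em_0|em] := eqVneq e`_m 0; first by exists 0.
  have /closed_rootP[w /rootP] : size e != 1%N; last by exists w.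
  apply: contra em => /eqP s1; rewrite nth_default // s1.
  exact: leq_trans m2.
have [/eqP bnc em] := em0 (ex_intro _ w0 ew0).
have w00 : w0 != 0.
  apply: contra em => /eqP w00; rewrite -conjC_eq0 -horner_revconj0 re hornerZ.
  by rewrite w00 in ew0; rewrite ew0 mulr0.
have [s s0 aE] := root_line _ ew0.
(* The reflection [w] of [w0] is also a root. Were it different from [w0], equating the two
   expressions of [a] would make [b] constant. *)
have w1 : `|w0| = 1.
  pose w := (w0^-1)^*.
  have ww : w0 != 0 -> w != 0 by rewrite conjC_eq0 invr_eq0.
  have ew : e.[w] = 0.
    have /eqP : (revconj m e).[w] = 0.
      by rewrite horner_revconj ?ww // /w -fmorphV invrK conjCK ew0 conjC0 mulr0.
    by rewrite re hornerZ mulf_eq0 oppr_eq0 (negPf f0) => /eqP.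
  have [s1 s10 aE1] := root_line _ ew.
  have [ew1|nw] := eqVneq w w0.
    have := mulVf w00; rewrite -[X in _ * X]ew1 /w -normCK normfV => /eqP.
    rewrite sqrf_eq1 => /orP[|] /eqP h.
      by rewrite -[LHS]invrK h invr1.
    by have := normr_ge0 w0^-1; rewrite normfV h oppr_ge0 ler10.
  have bE : b = ((s - s1) / (w - w0))%:P.
    have wn : w - w0 != 0 by rewrite subr_eq0.
    apply: (scalerI wn); rewrite -[RHS]mul_polyC -polyCM [_ * (_ / _)]mulrC divfK //.
    rewrite scalerBl polyCB; apply/eqP; rewrite subr_eq addrAC -subr_eq opprK.
    by rewrite -aE1 aE addrC.
  by move: bnc b0; rewrite bE size_polyC polyC_eq0 => + xn; rewrite xn.
(* W = w0 + s / b, so cheb is a polynomial g in b, read off from n expanded at w0. *)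
pose n1 := n \Po ('X + w0%:P).
have sn1 : (size n1 <= m.+1)%N by rewrite size_comp_poly2 // size_XaddC.
pose g := \poly_(i < m.+1) (n1`_(m - i) * s ^+ (m - i) / k).
have gE y : y != 0 -> g.[y] = y ^+ m * n.[w0 + s / y] / k.
  move=> y0; have -> : n.[w0 + s / y] = n1.[s / y].
    by rewrite horner_comp !hornerE addrC.
  have := homog_map (@idfun K) s sn1 y0; rewrite map_poly_id // => <-.
  rewrite horner_poly (reindex_inj rev_ord_inj) mulr_suml.
  apply: eq_bigr => i _ /=; rewrite subSS subKn; last by rewrite -ltnS.
  by ring.
have [d_w0 nd_w0] := Bb _ w1.
have n_w0 : n.[w0] != 0.
  by apply: contra_eq_neq nd_w0 => ->; rewrite mul0r normr0 eq_sym oner_eq0.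
(* The leading coefficient is [n(w0) / k], nonzero because [B] has modulus 1 at [w0]. *)
have sg : size g = m.+1.
  rewrite size_poly_eq //= subnn expr0 mulr1 mulf_neq0 ?invr_eq0 //.
  by rewrite -horner_coef0 horner_comp !hornerE.
have chebE : cheb = g \Po b.
  apply: (poly_eq_off_roots b0) => z bz; rewrite horner_comp gE //.
  have <- : a.[z] / b.[z] = w0 + s / b.[z].
    by rewrite aE !hornerE mulrDl mulfK.
  by rewrite -horner_homog // hn hornerZ mulrAC divff // mul1r.
have i0 := neq0Ci K; have n2 : 2 != 0 :> K by rewrite pnatr_eq0.
(* b = beta (t + i) with t real puts W = w0 + s / b on the unit circle. *)
pose beta := - s / (2 * 'i * w0).
have beta0 : beta != 0 by rewrite mulf_neq0 ?oppr_eq0 ?invr_eq0 ?mulf_neq0.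
pose V := beta^-1 *: b - 'i%:P.
pose G := (g \Po (beta *: ('X + 'i%:P))) + (2^-1)%:P.
have GV : cheb + (2^-1)%:P = G \Po V.
  rewrite chebE /G comp_polyD comp_polyC -comp_polyA comp_polyZ comp_polyD.
  by rewrite comp_polyX comp_polyC subrK scalerA mulfV // scale1r.
have sG : size G = m.+1.
  have sl : size (beta *: ('X + 'i%:P)) = 2%N by rewrite size_scale // size_XaddC.
  by rewrite size_polyDl size_comp_poly2 ?sg //
    (leq_ltn_trans (size_polyC_leq1 _)) // ltnS ltnW.
suff Gi : map_poly Num.conj G = - G.
  by have := cheb_comp_imaginary GV Gi; rewrite sG leqNgt ltnS m2.
(* Natural numbers [t] suffice as test points. If [V(z) = t], then [W(z)] is on the unit circle, so
   [|cheb(z)| = |cheb(z) + 1|]: the real part of [cheb(z)] is -1/2 and [G(t) = cheb(z) + 1/2] is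
   imaginary. *)
apply/eqP; rewrite -subr_eq0 opprK; apply/eqP.
apply: (poly0_inj_roots natr_inj) => j; rewrite hornerD.
set t := j%:R; have tr : t \is Num.real by rewrite rpred_nat.
have [ti1 ti2] := real_neq_i tr.
rewrite -{1}(conj_Creal tr) horner_map /=.
have [z Vz] : exists z, V.[z] = t.
  have /closed_rootP[z] : size (V - t%:P) != 1%N.
    rewrite /V -addrA -opprD -polyCD size_polyDl ?size_scale ?invr_eq0 //.
    rewrite size_polyN (leq_ltn_trans (size_polyC_leq1 _)) // ltn_neqAle.
    by rewrite eq_sym bnc size_poly_gt0.
  by rewrite /root hornerD hornerN hornerC subr_eq0 => /eqP; exists z.
have bzE : b.[z] = beta * (t + 'i).
  by rewrite -Vz !hornerE subrK mulrA mulfV // mul1r.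
have bz : b.[z] != 0 by rewrite bzE mulf_neq0.
have uE : a.[z] / b.[z] = w0 * (cayley t)^-1.
  rewrite aE !hornerE bzE /cayley /beta; field.
  by rewrite ti1 ti2 i0 w00 s0.
have [du ndu] : d.[a.[z] / b.[z]] != 0 /\ `|n.[a.[z] / b.[z]] / d.[a.[z] / b.[z]]| = 1.
  by apply: Bb; rewrite uE normrM normfV norm_cayley // w1 invr1 mulr1.
have normE : `|cheb.[z]| = `|cheb.[z] + 1|.
  apply: (mulfI (_ : `|k| != 0)); first by rewrite normr_eq0.
  rewrite -!normrM -hornerZ -hn horner_homog //.
  have -> : k * (cheb.[z] + 1) = (homog m d a b).[z].
    by rewrite hd hornerZ [in RHS]hornerD hornerC.
  by rewrite horner_homog // !normrM; move: ndu; rewrite normf_div => /divr1_eq->.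
have <- : cheb.[z] + 2^-1 = G.[t].
  by rewrite -Vz -horner_comp -GV [in RHS]hornerD hornerC.
rewrite rmorphD fmorphV rmorph_nat /=.
have := congr1 (fun x => x ^+ 2) normE; rewrite !normCK rmorphD rmorph1 /= => h.
have : (cheb.[z] + 1) * (cheb.[z]^* + 1) - cheb.[z] * cheb.[z]^* = 0.
  by rewrite h subrr.
by move=> <-; field.
Qed.

(** * Reducibility of the curve *)

Lemma subst_linZ c p (x : K) : subst_lin (c *: p) x = c%:P%:P * subst_lin p x.
Proof. by rewrite /subst_lin map_polyZ comp_polyZ [RHS]mul_polyC. Qed.

Lemma subst_lin_cheb (x : K) (Z := 'X + x%:P%:P * 'Y) :
  subst_lin cheb x = 4 * Z ^+ 4 - 4 * Z ^+ 2.
Proof.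
rewrite /subst_lin /cheb rmorphB /= !map_polyZ !map_polyXn /= rmorphB /=.
rewrite !comp_polyZ !comp_Xn_poly -/Z.
have -> : (4%:P : {poly K}) = 4 by rewrite polyC_natr.
by rewrite -!mul_polyC polyC_natr.
Qed.

Lemma subst_linD1 p (x : K) : subst_lin (p + 1) x = subst_lin p x + 1.
Proof. by rewrite /subst_lin !rmorphD !rmorph1. Qed.

(** For [r^2 = 8], the product of the quadrics for [r] and [-r] is [cheb(z) + cheb(w) + 1]. *)
Definition quadric (r : K) : {poly {poly K}} :=
  let z := 'X + 'i%:P%:P * 'Y in let w := 'X + (- 'i)%:P%:P * 'Y in
  2 * z ^+ 2 + 2 * w ^+ 2 - 1 - r%:P%:P * z * w.

(** On the line [y = 0] both [z] and [w] equal [x]. *)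
Lemma horner2_quadric r t : (quadric r).[t%:P].[0] = (4 - r) * t ^+ 2 - 1.
Proof.
rewrite /quadric !hornerE /=.
ring.
Qed.

(** A unit vanishes nowhere, but the quadric has a zero on the line [y = 0], since [r] is not 4. *)
Lemma quadric_nonunit r : r ^+ 2 = 8 -> quadric r \isn't a GRing.unit.
Proof.
move=> r2; have r4 : 4 - r != 0.
  apply/eqP => /eqP; rewrite subr_eq0 => /eqP r4; move/eqP: r2; rewrite -r4.
  by rewrite -natrX eqr_nat.
pose t := sqrtC (4 - r)^-1.
apply/negP => u; have := congr1 (fun f => f.[t%:P].[0]) (mulVr u).
rewrite !hornerM horner2_quadric sqrtCK mulfV // subrr mulr0 !hornerE => /eqP.
by rewrite eq_sym oner_eq0.
Qed.

Lemma cheb_reducible : reducible2 (L_poly cheb_ratfun).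
Proof.
have [c c0 [en ed]] := cheb_lowest_terms.
pose r : K := sqrtC 8; have r2 : r ^+ 2 = 8 by rewrite sqrtCK.
have chebc : map_poly Num.conj cheb = cheb.
  by rewrite /cheb rmorphB /= !map_polyZ !map_polyXn /= !rmorph_nat.
have cheb1c : map_poly Num.conj (cheb + 1) = cheb + 1.
  by rewrite [LHS]rmorphD /= [map_poly _ 1]rmorph1 chebc.
have LE : L_poly cheb_ratfun =
    - (c * c^*)%:P%:P * quadric r * quadric (- r).
  rewrite /L_poly en ed !map_polyZ /= chebc cheb1c.
  rewrite !subst_linZ !subst_linD1 !subst_lin_cheb /quadric !polyCM !polyCN.
  have : r%:P%:P ^+ 2 = 8 :> {poly {poly K}}.
    by rewrite -!polyC_exp r2 !polyC_natr.
  move: ('X + 'i%:P%:P * 'Y) ('X + - 'i%:P%:P * 'Y) (r%:P%:P) => z w rr rr2.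
  ring: rr2.
have kk : c * c^* != 0 by rewrite mulf_neq0 ?conjC_eq0.
split.
  (* At the origin both quadrics equal -1. *)
  apply/eqP => /(congr1 (fun f => f.[0%:P].[0])).
  rewrite LE !hornerM !horner2_quadric !(hornerN, hornerC, horner0).
  rewrite expr0n !mulr0 !sub0r !mulrN1 opprK => /eqP.
  by rewrite oppr_eq0 (negPf kk).
exists (- (c * c^*)%:P%:P * quadric r), (quadric (- r)); split=> //.
  by rewrite unitrM negb_and (quadric_nonunit r2) orbT.
by apply: quadric_nonunit; rewrite sqrrN.
Qed.

End NumClosed.

Theorem mainTheorem3 (R : realType) :
  exists P : ratfun R[i],
    [/\ nonconstant P, reducible2 (L_poly P) & ~ composition_condition P].
Proof.
exists (cheb_ratfun R[i]); split.
- exact: cheb_nonconstant.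
- exact: cheb_reducible.
- exact: cheb_no_composition.
Qed.
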